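(* Let $\ell_1,\ldots,\ell_n$ be positive integers and let $M$ be a positive common multiple of $\ell_1,\ldots,\ell_n$. Then the sets $$\mathcal F=\Big\{\mathbf u\in\mathbb Z_{\ge0}^n:\ \sum_{j=1}^n\ell_ju_j=M\Big\}\qquad\text{and}\qquad \mathcal S=\Big\{\mathbf u\in\mathbb Z_{\ge0}^n:\ \sum_{j=1}^n\ell_ju_j\equiv0\ \ \mathrm{mod}\ M\Big\}$$ generate the same subgroup of $\mathbb Z^n$. *)

(* Defs.v *)
From HB Require Import structures.
From mathcomp Require Import all_boot all_order all_algebra.
From mathcomp Require Import boolp classical_sets.

Set Implicit Arguments.
Unset Strict Implicit.
Unset Printing Implicit Defensive.

Import GRing.Theory Num.Theory.

Local Open Scope classical_set_scope.
Local Open Scope ring_scope.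

(* [smallest P G] is the intersection of all sets containing [G] that satisfy
   [P]; subgroups are closed under intersection, so this is a subgroup. *)
Definition subgroup_generated (V : zmodType) (G : set V) : set V :=
  smallest [set H : set V | GRing.zmod_closed [in H]] G.

Definition weighted_sum n (l : 'I_n -> nat) (u : 'rV[int]_n) : int :=
  \sum_(j < n) (l j)%:Z * u 0 j.

Definition level_set n (l : 'I_n -> nat) (M : nat) : set 'rV[int]_n :=
  [set u : 'rV[int]_n | (forall j, 0 <= u 0 j) /\ weighted_sum l u = M%:Z].

Definition congruence_set n (l : 'I_n -> nat) (M : nat) : set 'rV[int]_n :=
  [set u : 'rV[int]_n |
    (forall j, 0 <= u 0 j) /\ (weighted_sum l u = 0 %[mod M%:Z])%Z].

(* Main.v *)
Require Import Defs.
From HB Require Import structures.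
From mathcomp Require Import all_boot all_order all_algebra.
From mathcomp Require Import boolp classical_sets.
From mathcomp Require Import ring.

(** Both sets lie in the lattice of vectors of weight divisible by [M], so the
    point is that a subgroup [H] containing the vectors of weight exactly [M]
    contains every [u] whose weight is [k * M].  Subtracting [k] times the
    vector [(M / l i) e_i] of weight [M] reduces this to vectors of weight [0].

    Those are integer combinations of the two-term relations
    [(l j / d) e_i - (l i / d) e_j], where [d] is the gcd of all the weights:
    if [d = \sum_j c_j l_j] and [u] has weight [0], then
    [u = \sum_i \sum_j c_j u_i ((l j / d) e_i - (l i / d) e_j)],
    because the first terms add up to [u] and the second ones to a multiple of
    the weight of [u] ([weight0_in_subgroup]).

    Each such relation is a multiple of the primitive one
    [(m / l i) e_i - (m / l j) e_j] with [m = lcm (l i) (l j)].  As [m] divides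
    [M], both terms of the latter can be completed to nonnegative vectors of
    weight [M] by adding the same multiple [((M - m) / l i) e_i]; their
    difference is therefore in [H] ([primitive_relation_in_subgroup]). *)

Set Implicit Arguments.
Unset Strict Implicit.
Unset Printing Implicit Defensive.

Import GRing.Theory Num.Theory.

Local Open Scope classical_set_scope.
Local Open Scope ring_scope.

(** The subgroups are quantified as bundled [zmodClosed] predicates, so that the
    [rpred] lemmas apply to them. *)
Lemma sub_subgroup_generated (V : zmodType) (A B : set V) :
  (forall H : zmodClosed V,
     (forall x, B x -> x \in H) -> forall x, A x -> x \in H) ->
  subgroup_generated A `<=` subgroup_generated B.
Proof.
move=> AB x Ax H [HC BH]; apply: Ax; split=> // y Ay.
pose Hmixin := GRing.isZmodClosed.Build V [in H] HC.
pose K : zmodClosed V := HB.pack [in H] Hmixin.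
apply/set_mem; apply: (AB K) Ay => z Bz.
exact/mem_set/BH.
Qed.

Lemma bezout_family n (l : 'I_n -> nat) :
  exists c : 'I_n -> int,
    \sum_(j < n) c j * (l j)%:Z = (\big[gcdn/0]_(j < n) l j)%N%:Z.
Proof.
apply: (big_ind (fun g => exists c : 'I_n -> int,
                   \sum_(j < n) c j * (l j)%:Z = g%:Z)) => [|x y|i _].
- by exists (fun=> 0); rewrite big1 // => j _; rewrite mul0r.
- move=> [a aE] [b bE]; have [u [v uvE]] := Bezoutz x%:Z y%:Z.
  exists (fun j => u * a j + v * b j).
  rewrite -[RHS]uvE -aE -bE !mulr_sumr -big_split /=.
  by apply: eq_bigr => j _; rewrite mulrDl !mulrA.
- exists (fun j => (j == i)%:R); rewrite (bigD1 i) //= eqxx mul1r big1 ?addr0 //.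
  by move=> j /negPf->; rewrite mul0r.
Qed.

Section Weights.
Variables (n : nat) (l : 'I_n -> nat).

Local Notation e i := (delta_mx 0 i : 'rV[int]_n).

Lemma weighted_sum_is_zmod_morphism : zmod_morphism (weighted_sum l).
Proof.
move=> u v; rewrite /weighted_sum -sumrB; apply: eq_bigr => j _.
by rewrite !mxE mulrBr.
Qed.

HB.instance Definition _ := GRing.isZmodMorphism.Build 'rV[int]_n int
  (weighted_sum l) weighted_sum_is_zmod_morphism.

Lemma weighted_sum_delta i : weighted_sum l (e i) = (l i)%:Z.
Proof.
rewrite /weighted_sum (bigD1 i) //= big1 => [|j /negPf ji].
  by rewrite mxE !eqxx mulr1 addr0.
by rewrite mxE ji andbF mulr0.
Qed.

Variables (M : nat).

Lemma two_term_level i j a b : (l i * a + l j * b = M)%N ->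
  level_set l M (e i *+ a + e j *+ b).
Proof.
move=> ME; split=> [k|].
  by rewrite mxE !mulmxnE !mxE addr_ge0 // mulrn_wge0 ?ler0n.
rewrite raddfD /= !raddfMn /= !weighted_sum_delta -ME PoszD !PoszM.
by rewrite -[_ *+ a]mulr_natr -[_ *+ b]mulr_natr !natz.
Qed.

Hypothesis l_gt0 : forall j, (0 < l j)%N.
Hypothesis M_gt0 : (0 < M)%N.
Hypothesis l_dvd_M : forall j, (l j %| M)%N.

Variable H : zmodClosed 'rV[int]_n.
Hypothesis level_sub : forall u, level_set l M u -> u \in H.

(** Here the assumption that [M] is a common multiple enters: it makes the
    weight [lcmn (l i) (l j)] of either term small enough, and [M] minus it
    divisible by [l i], so that both terms have a common completion. *)
Lemma primitive_relation_in_subgroup i j :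
  e i *+ (lcmn (l i) (l j) %/ l i) - e j *+ (lcmn (l i) (l j) %/ l j) \in H.
Proof.
set m := lcmn _ _.
have m_dvd_M : (m %| M)%N by rewrite dvdn_lcm !l_dvd_M.
have m_le_M : (m <= M)%N by rewrite dvdn_leq.
have lim : (l i %| m)%N by apply: dvdn_lcml.
have ljm : (l j %| m)%N by apply: dvdn_lcmr.
set r := ((M - m) %/ l i)%N.
have rE : (l i * r = M - m)%N by rewrite mulnC divnK // dvdn_sub.
rewrite -(addrKA (e i *+ r)).
apply: rpredB; apply/level_sub/two_term_level; rewrite rE mulnC divnK //.
  by rewrite subnKC.
by rewrite subnK.
Qed.

(** This multiplies the primitive relation by [gcdn (l i) (l j) %/ d], since
    [l j = (lcmn (l i) (l j) %/ l i) * gcdn (l i) (l j)] and symmetrically.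
    All pairs thereby share one denominator [d], as the double sum in
    [weight0_in_subgroup] requires. *)
Lemma relation_in_subgroup d i j : (d %| l i)%N -> (d %| l j)%N ->
  e i *+ (l j %/ d) - e j *+ (l i %/ d) \in H.
Proof.
move=> di dj; have d_gt0 : (0 < d)%N by apply: dvdn_gt0 di.
have dg : (d %| gcdn (l i) (l j))%N by rewrite dvdn_gcd di.
have quotE x y : (0 < x)%N ->
    (d %| y)%N -> (d %| gcdn x y)%N ->
    (y %/ d = lcmn x y %/ x * (gcdn x y %/ d))%N.
  move=> x0 dy dxy; apply/eqP; rewrite -(eqn_pmul2r d_gt0) divnK //.
  rewrite -mulnA divnK // -(eqn_pmul2l x0) mulnA (mulnC x (_ %/ x)%N).
  by rewrite divnK ?dvdn_lcml // muln_lcm_gcd.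
rewrite (quotE (l i) (l j)) // (quotE (l j) (l i)) // 1?gcdnC //.
rewrite (lcmnC (l j)) (gcdnC (l j)) !mulrnA -mulrnBl.
exact/rpredMn/primitive_relation_in_subgroup.
Qed.

(** [*:] rather than [*~] is used for integer multiples because it computes on
    entries through [mxE]. *)
Lemma rpred_scale_int (a : int) u : u \in H -> a *: u \in H.
Proof. by move=> uH; rewrite -[a]intz scaler_int rpredMz. Qed.

(** Bezout coefficients of the gcd [d] of the weights average the relations:
    the [i]-th entry [u 0 i] is spread over all pairs [(i, j)] with the
    coefficients [c j * (l j / d)], whose sum over [j] is [1]. *)
Lemma weight0_in_subgroup u : weighted_sum l u = 0 -> u \in H.
Proof.
move=> u0; have [c cE] := bezout_family l.
move: cE; set d := (\big[gcdn/0]_(j < n) l j)%N => cE.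
have d_dvd j : (d %| l j)%N by apply: biggcdn_inf (dvdnn _).
have quotK j : (l j)%:Z = (l j %/ d)%N%:Z * d%:Z by rewrite -PoszM divnK.
suff -> : u = \sum_i \sum_j (c j * u 0 i) *:
                (e i *+ (l j %/ d) - e j *+ (l i %/ d)).
  apply: rpred_sum => i _; apply: rpred_sum => j _.
  exact/rpred_scale_int/relation_in_subgroup.
apply/rowP => k.
(* The column index k witnesses that there is at least one weight. *)
have d_neq0 : d%:Z != 0.
  by apply: contraTneq (l_gt0 k) => d0; rewrite -ltz_nat quotK d0 mulr0.
have sum_c : \sum_j c j * (l j %/ d)%N%:Z = 1.
  apply: (mulIf d_neq0); rewrite mul1r -[RHS]cE mulr_suml.
  by apply: eq_bigr => j _; rewrite -mulrA -quotK.
have sum_u : \sum_i u 0 i * (l i %/ d)%N%:Z = 0.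
  apply: (mulIf d_neq0); rewrite mul0r -[RHS]u0 mulr_suml.
  by apply: eq_bigr => i _; rewrite -mulrA -quotK mulrC.
rewrite summxE.
under eq_bigr => i _.
  rewrite summxE.
  under eq_bigr => j _.
    rewrite !mxE !mulmxnE !mxE !eqxx /= -[_ *+ (l j %/ d)]mulr_natr.
    rewrite -[_ *+ (l i %/ d)]mulr_natr.
    rewrite (natz (l j %/ d)) (natz (l i %/ d)) mulrBr.
    have -> : c j * u 0 i * ((k == i)%:R * (l j %/ d)%N%:Z) =
              u 0 i * (k == i)%:R * (c j * (l j %/ d)%N%:Z) by ring.
    have -> : c j * u 0 i * ((k == j)%:R * (l i %/ d)%N%:Z) =
              u 0 i * (l i %/ d)%N%:Z * (c j * (k == j)%:R) by ring.
    over.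
  rewrite sumrB -!mulr_sumr sum_c mulr1.
  over.
rewrite sumrB -mulr_suml sum_u mul0r subr0 (bigD1 k) //= eqxx mulr1.
by rewrite big1 ?addr0 // => i /negPf ik; rewrite eq_sym ik mulr0.
Qed.

Lemma congruence_in_subgroup u : congruence_set l M u -> u \in H.
Proof.
case=> _ /eqP; rewrite eqz_mod_dvd subr0 => /dvdzP[k kE].
have [i0 _|no_index] := pickP (fun i : 'I_n => true); last first.
  suff -> : u = 0 by apply: rpred0.
  by apply/rowP => i; have := no_index i.
(* The null second term puts f in the shape expected by two_term_level. *)
pose f := e i0 *+ (M %/ l i0) + e i0 *+ 0.
have fM : level_set l M f.
  by apply: two_term_level; rewrite muln0 addn0 mulnC divnK.
rewrite -(subrK (k *: f) u) rpredD //; last exact/rpred_scale_int/level_sub.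
apply: weight0_in_subgroup.
rewrite raddfB /= kE -[k in k *: f]intz scaler_int raddfMz /= fM.2.
by rewrite -mulrzr intz mulrC subrr.
Qed.

Lemma level_sub_congruence u : level_set l M u -> congruence_set l M u.
Proof. by case=> u_ge0 uM; split=> //; rewrite uM modzz mod0z. Qed.

End Weights.

Theorem theorem5p3 (n : nat) (l : 'I_n -> nat) (M : nat)
    (l_gt0 : forall j : 'I_n, (0 < l j)%N)
    (M_gt0 : (0 < M)%N)
    (l_dvd_M : forall j : 'I_n, (l j %| M)%N) :
  subgroup_generated (level_set l M) = subgroup_generated (congruence_set l M).
Proof.
apply/seteqP; split; apply: sub_subgroup_generated => H subH u.
- by move/level_sub_congruence; apply: subH.
- exact: congruence_in_subgroup.
Qed.
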